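(* Let $d\ge2$ be an integer with prime factorisation $d=\prod_{i=1}^r p_i^{m_i}$ ($p_i$ distinct primes, $m_i\ge1$), and let $n\ge1$, $0\le k<n$. Then the number of $[[n,k]]_d$ stabilizer codes satisfies $$N(n,k,d)=\prod_{i=1}^r N(n,k,p_i^{m_i}),$$ and consequently $$N(n,k,d)=d^{\frac{(n-k)(n+3k+1)}{2}}\prod_{i=1}^r\zeta_i,\qquad \zeta_i:=\prod_{j=0}^{n-k-1}\frac{1-p_i^{-2(n-j)}}{1-p_i^{-(n-k-j)}}.$$
   Context: $N(n,k,q)$ denotes the number of $[[n,k]]_q$ stabilizer codes for qudits of dimension $q$ with configuration space $\mathbb{Z}_q$ (integers mod $q$). Definitions: $\Lambda=\begin{pmatrix}0&I_n\\-I_n&0\end{pmatrix}$; on $\mathbb{C}^q$ with basis $\{|j\rangle\}_{j\in\mathbb{Z}_q}$, $X|j\rangle=|j+1\rangle$, $Z|j\rangle=\omega^j|j\rangle$, $\omega=e^{2\pi i/q}$; the $n$-qudit Pauli group is generated by the $X_j,Z_j$ (and $e^{\pi i/q}I$ if $q$ even), each Pauli being a phase times $g(a)=X^{u_1}Z^{v_1}\otimes\cdots\otimes X^{u_n}Z^{v_n}$, $a=(u,v)\in\mathbb{Z}_q^{2n}$, with $g(a),g(b)$ commuting iff $a^T\Lambda b=0$. An $[[n,k]]_q$ stabilizer group is $S=\langle g_1,\dots,g_{n-k}\rangle$ of pairwise commuting Paulis each with eigenvalue $+1$ and $|S|=q^{n-k}$; its check matrix is $H=[a_1|\cdots|a_{n-k}]$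 with $g_j$ a phase times $g(a_j)$. Two stabilizer groups define the same stabilizer code iff their check matrices satisfy $H'=HA$ for some invertible $A$ over $\mathbb{Z}_q$; equivalently a code is the subgroup of $\mathbb{Z}_q^{2n}$ spanned by $n-k$ linearly independent (over $\mathbb{Z}_q$: $\sum x_ja_j=0\Rightarrow$ all $x_j=0$), pairwise symplectically orthogonal vectors. *)

(* Defs.v *)
From HB Require Import structures.
From mathcomp Require Import all_boot all_order all_algebra.
Set Implicit Arguments. Unset Strict Implicit. Unset Printing Implicit Defensive.
Import GRing.Theory.
Local Open Scope ring_scope.

(* Vectors a = (u,v) in Z_q^{2n} are row vectors of width n + n:
   the first n coordinates are u, the last n are v.  'Z_q is only a
   genuine Z/qZ for q >= 2 (it is used only with such q). *)

Definition Lambda (q n : nat) : 'M['Z_q]_(n + n) :=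
  block_mx 0 1%:M (- 1%:M) 0.

Definition sympl (q n : nat) (a b : 'rV['Z_q]_(n + n)) : 'Z_q :=
  (a *m Lambda q n *m b^T) 0 0.

Definition lin_indep (q n m : nat) (a : {ffun 'I_m -> 'rV['Z_q]_(n + n)}) : bool :=
  [forall x : {ffun 'I_m -> 'Z_q},
     (\sum_(j < m) x j *: a j == 0) ==> [forall j, x j == 0]].

Definition pairwise_orth (q n m : nat) (a : {ffun 'I_m -> 'rV['Z_q]_(n + n)}) : bool :=
  [forall i, forall j, sympl (a i) (a j) == 0].

Definition span_set (q n m : nat) (a : {ffun 'I_m -> 'rV['Z_q]_(n + n)})
  : {set 'rV['Z_q]_(n + n)} :=
  [set \sum_(j < m) x j *: a j | x : {ffun 'I_m -> 'Z_q}].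

Definition stab_codes (n k q : nat) : {set {set 'rV['Z_q]_(n + n)}} :=
  [set C | [exists a : {ffun 'I_(n - k) -> 'rV['Z_q]_(n + n)},
              [&& lin_indep a, pairwise_orth a & C == span_set a]]].

Definition N (n k q : nat) : nat := #|stab_codes n k q|.

(* Main.v *)
Require Import Defs.
From mathcomp Require Import all_boot all_order all_algebra zify.
Set Implicit Arguments. Unset Strict Implicit. Unset Printing Implicit Defensive.
Import GRing.Theory Num.Theory.
Local Open Scope ring_scope.

(* Independent vectors over Z_q start a basis of the ambient free module (Smith
   normal form). Reading the conditions in such a basis, an isotropic frame of j
   vectors in a nondegenerate alternating space of rank l extends by one vector in
   q^j J(l - 2j) ways, J(r) being the number of independent vectors of Z_q^r, and
   an independent family of j vectors of Z_q^m in q^j J(m - j) ways. A code with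
   m = n - k generators has as many frames as Z_q^m has bases, so that
   N = prod_(j < m) J(2(n - j)) / J(m - j); finally a sieve over the primes
   dividing q gives J(r) = q^r prod_(p | q) (1 - p^-r). *)

Lemma coprime_primes_dvdn (q c : nat) : (0 < q)%N ->
  coprime q c = all (fun p => ~~ (p %| c)%N) (primes q).
Proof.
move=> q_gt0; apply/idP/allP => [co_qc p | ndvd].
  rewrite mem_primes => /and3P[p_pr _ p_q].
  by rewrite -prime_coprime // (coprime_dvdl p_q).
apply/negPn/negP => gcd_neq1.
have gcd_gt1 : (1 < gcdn q c)%N by rewrite ltn_neqAle eq_sym gcd_neq1 gcdn_gt0 q_gt0.
have /ndvd/negP[] : pdiv (gcdn q c) \in primes q.
  by rewrite mem_primes pdiv_prime // q_gt0 (dvdn_trans (pdiv_dvd _)) ?dvdn_gcdl.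
by rewrite (dvdn_trans (pdiv_dvd _)) ?dvdn_gcdr.
Qed.

Lemma prod_primes_logn (q : nat) : (0 < q)%N ->
  (\prod_(p <- primes q) p ^ logn p q)%N = q.
Proof.
by move=> q_gt0; rewrite [RHS]prod_prime_decomp // prime_decompE big_map.
Qed.

Lemma prod_primes_dvdn (q : nat) : (0 < q)%N -> (\prod_(p <- primes q) p %| q)%N.
Proof.
move=> q_gt0; rewrite -[X in (_ %| X)%N]prod_primes_logn //.
rewrite big_seq [X in (_ %| X)%N]big_seq.
apply: (big_ind2 (fun a b => a %| b)%N) => // [a1 a2 b1 b2|p p_q]; first exact: dvdn_mul.
by rewrite dvdn_exp ?logn_gt0.
Qed.

Lemma sum_subn_ord (m a : nat) : (m <= a.+1)%N ->
  (\sum_(j < m) (a - j) = (m * (2 * a + 1 - m)) %/ 2)%N.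
Proof.
move=> m_a; suff: (2 * \sum_(j < m) (a - j) = m * (2 * a + 1 - m))%N.
  by move=> <-; rewrite mulKn.
elim: m m_a => [|m IHm] m_a; first by rewrite big_ord0.
by rewrite big_ord_recr mulnDr IHm ?(ltnW m_a) //=; nia.
Qed.

Section Sieve.

Variables (F : comPzRingType) (T : finType) (c : T -> nat) (density : nat -> F).
Hypothesis densityM : forall a b, coprime a b -> density (a * b) = density a * density b.

(* The factor [e] makes the induction on [ps] go through: discarding from
   [e %| c t] the elements with [p %| c t] discards those with [e * p %| c t]. *)
Lemma card_sieve_dvdn (e : nat) (ps : seq nat) :
  all prime ps -> uniq ps -> all (coprime e) ps ->
  (forall e', (e' %| e * \prod_(p <- ps) p)%N ->
     #|[set t | (e' %| c t)%N]|%:R = #|T|%:R * density e') ->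
  #|[set t | (e %| c t)%N && all (fun p => ~~ (p %| c t)%N) ps]|%:R =
    #|T|%:R * density e * \prod_(p <- ps) (1 - density p).
Proof.
elim: ps e => [|p ps IHps] e /=.
  move=> _ _ _ card_dvdn; rewrite big_nil mulr1 -card_dvdn ?dvdn_mulr //.
  by under eq_finset do rewrite andbT.
case/andP=> p_pr ps_pr /andP[p_ps ps_uniq] /andP[co_ep co_eps] card_dvdn.
have co_ps : all (coprime (e * p)) ps.
  apply/allP => p' p'_ps; rewrite coprimeMl (allP co_eps) //=.
  rewrite prime_coprime // dvdn_prime2 ?(allP ps_pr p') //.
  by apply: contraNneq p_ps => ->.
have := IHps _ ps_pr ps_uniq co_eps; set A := [set t | _] => cardA.
have := IHps _ ps_pr ps_uniq co_ps; set B := [set t | _] => cardB.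
have inB t : (t \in B) = (t \in A) && (p %| c t)%N.
  by rewrite !inE Gauss_dvd // andbAC.
have -> : [set t | (e %| c t)%N &&
    (~~ (p %| c t)%N && all (fun p => ~~ (p %| c t)%N) ps)] = A :\: B.
  apply/setP => t; rewrite inE in_setD inB inE.
  by case: (e %| _)%N; case: (p %| _)%N; case: all.
have sBA : B \subset A by apply/subsetP => t; rewrite inB => /andP[].
rewrite cardsD (setIidPr sBA) natrB ?subset_leq_card //.
rewrite cardA => [|e' e'_dvd]; last first.
  by apply: card_dvdn; rewrite (dvdn_trans e'_dvd) // big_cons mulnCA dvdn_mull.
rewrite cardB => [|e' e'_dvd]; last by apply: card_dvdn; rewrite big_cons mulnA.
by rewrite densityM // big_cons mulrA -mulrBl mulrA mulrBr mulr1.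
Qed.

Lemma card_coprime (q : nat) : (0 < q)%N ->
  (forall e, (e %| q)%N -> #|[set t | (e %| c t)%N]|%:R = #|T|%:R * density e) ->
  #|[set t | coprime q (c t)]|%:R =
    #|T|%:R * \prod_(p <- primes q) (1 - density p).
Proof.
move=> q_gt0 card_dvdn.
have -> : #|T|%:R = #|T|%:R * density 1.
  rewrite -card_dvdn ?dvd1n // -cardsT; congr (#|pred_of_set _|%:R).
  by apply/setP => t; rewrite !inE dvd1n.
rewrite -card_sieve_dvdn ?primes_uniq //.
- congr (_%:R); apply: eq_card => t.
  by rewrite !inE dvd1n coprime_primes_dvdn.
- by apply/allP => p; rewrite mem_primes => /andP[].
- by apply/allP => p _; rewrite coprime1n.
- move=> e; rewrite mul1n => e_dvd; apply: card_dvdn.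
  exact: dvdn_trans e_dvd (prod_primes_dvdn q_gt0).
Qed.

End Sieve.

Lemma card_rV_on (T : finType) (r : nat) (A : {pred T}) :
  #|[set v : 'rV[T]_r | [forall i, v 0 i \in A]]| = (#|A| ^ r)%N.
Proof.
have row_bij : bijective (fun f : {ffun 'I_r -> T} => \row_i f i).
  exists (fun v : 'rV_r => [ffun i => v 0 i]) => [f|v].
    by apply/ffunP => i; rewrite ffunE mxE.
  by apply/rowP => i; rewrite mxE ffunE.
rewrite -(on_card_preimset (onW_bij _ row_bij)) -[r in RHS]card_ord -card_ffun_on.
by apply: eq_card => f; rewrite !inE; apply: eq_forallb => i; rewrite mxE.
Qed.

Lemma card_col_mx (T : finType) (m l c : nat) (P1 : pred 'M[T]_(1 + m, l))
    (P0 : pred 'M[T]_(m, l)) :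
  (forall b H, P1 (col_mx b H) -> P0 H) ->
  (forall H, P0 H -> #|[set b | P1 (col_mx b H)]| = c) ->
  #|[set X | P1 X]| = (#|[set H | P0 H]| * c)%N.
Proof.
move=> P1_dsub card_ext.
rewrite -sum1_card (partition_big dsubmx P0) => [|X]; last first.
  by rewrite inE -{1}[X]vsubmxK => /P1_dsub.
rewrite cardsE -sum_nat_const; apply: eq_bigr => H /card_ext <-.
rewrite sum1dep_card -(card_imset _ (can_inj (@col_mxKu _ 1 m l ^~ H))).
apply: eq_card => X; rewrite !inE; apply/andP/imsetP => [[PX /eqP <-]|[b + ->]].
  by exists (usubmx X); rewrite ?inE vsubmxK.
by rewrite inE col_mxKd.
Qed.

Lemma card_mx_tower (T : finType) (l n : nat) (P : forall m, pred 'M[T]_(m, l))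
    (extensions : nat -> nat) :
  (forall H, P 0 H) ->
  (forall m (b : 'rV_l) (H : 'M_(m, l)), P m.+1 (col_mx b H) -> P m H) ->
  (forall m (H : 'M_(m, l)), (m < n)%N -> P m H ->
     #|[set b : 'rV_l | P m.+1 (col_mx b H)]| = extensions m) ->
  #|[set H | P n H]| = (\prod_(m < n) extensions m)%N.
Proof.
move=> P0 P_dsub; elim: n => [|n IHn] card_ext.
  rewrite big_ord0 (_ : [set H | _] = setT) ?cardsT ?card_mx ?mul0n //.
  by apply/setP => H; rewrite !inE P0.
rewrite big_ord_recr /= -IHn => [|m H m_n]; last by apply: card_ext; rewrite ltnW.
by apply: card_col_mx => [|H]; [exact: P_dsub | exact: card_ext].
Qed.

Section IndependentRows.

Variable R : finComUnitRingType.
Implicit Types k l m n r s : nat.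

Definition row_indep m l (H : 'M[R]_(m, l)) : bool :=
  [forall x : 'rV_m, (x *m H == 0) ==> (x == 0)].

Lemma row_indepP m l (H : 'M[R]_(m, l)) :
  reflect (forall x : 'rV_m, x *m H = 0 -> x = 0) (row_indep H).
Proof.
apply: (iffP forallP) => [indep x xH | indep x].
  by apply/eqP; apply: (implyP (indep x)); apply/eqP.
by apply/implyP => /eqP/indep ->.
Qed.

Lemma row_indep_inj k m l (H : 'M[R]_(m, l)) :
  row_indep H -> injective (fun X : 'M_(k, m) => X *m H).
Proof.
move=> /row_indepP indep X Y /= XH; apply/row_matrixP => i; apply/subr0_eq/indep.
by rewrite mulmxBl -!row_mul XH subrr.
Qed.

Lemma row_indep0 l (H : 'M[R]_(0, l)) : row_indep H.
Proof. by apply/row_indepP => x _; apply: thinmx0. Qed.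

Lemma row_indep_mul m n l (A : 'M[R]_(m, n)) (B : 'M_(n, l)) :
  row_indep B -> row_indep (A *m B) = row_indep A.
Proof.
move=> /row_indepP indepB; apply/row_indepP/row_indepP => indep x.
  by move=> xA; apply: indep; rewrite mulmxA xA mul0mx.
by rewrite mulmxA => /indepB/indep.
Qed.

Lemma row_indep_unitmx m (X : 'M[R]_m) : row_indep X = (X \in unitmx).
Proof.
apply/idP/idP => [/(@row_indep_inj m)/injF_bij[Y _ YK] | X_unit].
  by have [] := mulmx1_unit (YK 1%:M).
by apply/row_indepP => x xX; rewrite -(mulmxK X_unit x) xX mul0mx.
Qed.

Lemma row_indep_dsub k m l (B : 'M[R]_(k, l)) (H : 'M_(m, l)) :
  row_indep (col_mx B H) -> row_indep H.
Proof.
move=> /row_indepP indep; apply/row_indepP => x xH.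
have := indep (row_mx 0 x); rewrite mul_row_col mul0mx add0r => /(_ xH).
by move/(congr1 rsubmx); rewrite row_mxKr linear0.
Qed.

Lemma row_indep_row0 k m r (M : 'M[R]_(k, r)) :
  row_indep (row_mx (0 : 'M_(k, m)) M) = row_indep M.
Proof.
apply/row_indepP/row_indepP => indep x; rewrite ?mul_mx_row ?mulmx0.
  by move=> xM; apply: indep; rewrite mul_mx_row mulmx0 xM row_mx0.
by rewrite -row_mx0 => /eq_row_mx[_ /indep].
Qed.

Lemma row_indep_col_row1 k m r (A : 'M[R]_(k, m)) (M : 'M_(k, r)) :
  row_indep (col_mx (row_mx A M) (row_mx 1%:M 0)) = row_indep M.
Proof.
apply/row_indepP/row_indepP => indep x.
  move=> xM; have := indep (row_mx x (- (x *m A))).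
  rewrite mul_row_col !mul_mx_row mulmx1 mulmx0 xM add_row_mx subrr add0r row_mx0.
  by move=> /(_ erefl)/(congr1 lsubmx); rewrite row_mxKl linear0.
rewrite -[x]hsubmxK mul_row_col !mul_mx_row mulmx1 mulmx0 add_row_mx addr0 -row_mx0.
case/eq_row_mx => + /indep x0; rewrite x0 mul0mx add0r => ->.
by rewrite !row_mx0.
Qed.

Lemma row_indep_completion k m r (H : 'M[R]_(m, m + r)) (K : 'M_(r, m + r))
    (A : 'M_(k, m)) (M : 'M_(k, r)) :
  col_mx H K \in unitmx ->
  row_indep (col_mx (row_mx A M *m col_mx H K) H) = row_indep M.
Proof.
rewrite -row_indep_unitmx => indepV; rewrite -(row_indep_col_row1 A M).
rewrite -[RHS](row_indep_mul _ indepV) mul_col_mx.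
by rewrite (mul_row_col 1%:M) mul1mx mul0mx addr0.
Qed.

(* For R = Z/q this is Jordan's totient J_r(q). *)
Definition jordan_totient r : nat := #|[set v : 'rV[R]_r | row_indep v]|.

Definition row_span m l (A : 'M[R]_(m, l)) : {set 'rV[R]_l} :=
  [set x *m A | x : 'rV_m].

Lemma row_span_unitmx m l (X : 'M[R]_m) (A : 'M_(m, l)) :
  X \in unitmx -> row_span (X *m A) = row_span A.
Proof.
move=> X_unit; apply/setP => v; apply/imsetP/imsetP => -[x _ ->].
  by exists (x *m X); rewrite ?mulmxA.
by exists (x *m invmx X); rewrite ?mulmxA ?mulmxKV.
Qed.

Lemma eq_row_spanP m l (A B : 'M[R]_(m, l)) : row_indep A -> row_indep B ->
  reflect (exists2 X, X \in unitmx & B = X *m A) (row_span B == row_span A).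
Proof.
move=> indepA indepB; apply: (iffP eqP) => [spanB | [X X_unit ->]]; last first.
  exact: row_span_unitmx.
have row_B i : exists x : 'rV_m, row i B == x *m A.
  have : row i B \in row_span A by rewrite -spanB rowE; apply: imset_f.
  by case/imsetP => x _ ->; exists x.
have BE : B = (\matrix_i xchoose (row_B i)) *m A.
  by apply/row_matrixP => i; rewrite row_mul rowK; apply/eqP/(xchooseP (row_B i)).
exists (\matrix_i xchoose (row_B i)) => //.
by rewrite -row_indep_unitmx -(row_indep_mul _ indepA) -BE.
Qed.

Lemma card_row_spans m l (F : {set 'M[R]_(m, l)}) :
  (forall A, A \in F -> row_indep A) ->
  (forall X A, X \in unitmx -> A \in F -> X *m A \in F) ->
  #|F| = (#|[set row_span A | A in F]| * #|[set X : 'M[R]_m | row_indep X]|)%N.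
Proof.
move=> indepF unitF; rewrite -sum1_card (partition_big_imset (@row_span m l)).
rewrite -sum_nat_const; apply: eq_bigr => _ /imsetP[A FA ->].
rewrite sum1dep_card -(card_imset _ (@row_indep_inj m _ _ _ (indepF A FA))).
apply: eq_card => B; rewrite !inE; apply/andP/imsetP => [[FB] | [X + ->]].
  case/(eq_row_spanP (indepF A FA) (indepF B FB)) => X X_unit ->.
  by exists X => //; rewrite inE row_indep_unitmx.
by rewrite inE row_indep_unitmx => X_unit; rewrite unitF // row_span_unitmx.
Qed.

Definition alternating l (L : 'M[R]_l) : Prop :=
  forall a : 'rV_l, a *m L *m a^T = 0.

Lemma alternating_tr l (L : 'M[R]_l) : alternating L -> L^T = - L.
Proof.
move=> altL.
have entry i j : L i j = (delta_mx 0 i *m L *m (delta_mx 0 j)^T :> 'M_1) 0 0.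
  by rewrite trmx_delta -rowE -colE !mxE.
apply/matrixP => i j; rewrite !mxE; apply/eqP; rewrite -addr_eq0 !entry.
have := altL (delta_mx 0 i + delta_mx 0 j).
rewrite linearD /= mulmxDl !mulmxDr !mulmxDl !altL add0r addr0.
by move/matrixP/(_ 0 0); rewrite mxE => ->; rewrite mxE.
Qed.

Definition isotropic m l (L : 'M[R]_l) (H : 'M[R]_(m, l)) : bool :=
  H *m L *m H^T == 0.

Lemma isotropic_mul k m l (L : 'M[R]_l) (X : 'M_(k, m)) (H : 'M[R]_(m, l)) :
  isotropic L H -> isotropic L (X *m H).
Proof.
rewrite /isotropic => /eqP isoH.
by rewrite trmx_mul -!mulmxA (mulmxA H) (mulmxA _ H^T) isoH mul0mx mulmx0.
Qed.

Lemma isotropic_col_mx m l (L : 'M[R]_l) (b : 'rV_l) (H : 'M_(m, l)) :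
  alternating L ->
  isotropic L (col_mx b H) = isotropic L H && (b *m (H *m L)^T == 0).
Proof.
move=> altL; rewrite /isotropic.
have bHL : b *m (H *m L)^T = - (b *m L *m H^T).
  by rewrite trmx_mul alternating_tr // mulNmx mulmxN mulmxA.
rewrite mul_col_mx tr_col_mx mul_col_row altL.
have -> : H *m L *m b^T = (b *m (H *m L)^T)^T by rewrite [RHS]trmx_mul trmxK.
rewrite bHL linearN /= oppr_eq0; apply/eqP/andP => [|[/eqP-> /eqP->]].
  by rewrite -block_mx0 => /eq_block_mx[_ -> _ ->].
by rewrite trmx0 oppr0 block_mx0.
Qed.

Definition isotropic_frames m l (L : 'M[R]_l) : {set 'M[R]_(m, l)} :=
  [set H | row_indep H && isotropic L H].

Definition isotropic_spaces m l (L : 'M[R]_l) : {set {set 'rV[R]_l}} :=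
  [set row_span A | A in isotropic_frames m L].

Lemma card_isotropic_frames_spaces m l (L : 'M[R]_l) :
  #|isotropic_frames m L| =
    (#|isotropic_spaces m L| * #|[set X : 'M[R]_m | row_indep X]|)%N.
Proof.
apply: card_row_spans => [A | X A X_unit]; rewrite !inE => /andP[indepA isoA] //.
by rewrite row_indep_mul // row_indep_unitmx X_unit isotropic_mul.
Qed.

Definition Steinitz_ring : Prop :=
  forall m r (H : 'M[R]_(m, m + r)), row_indep H ->
  exists K : 'M_(r, m + r), col_mx H K \in unitmx.

Hypothesis steinitzR : Steinitz_ring.

Lemma dual_completion m k s (H : 'M[R]_(m, m + (k + s))) (G : 'M_(k, m + (k + s))) :
  row_indep H -> row_indep G -> H *m G^T = 0 ->
  exists2 K, col_mx H K \in unitmx & K *m G^T = col_mx 1%:M 0.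
Proof.
move=> /steinitzR[K V_unit] indepG HG.
have indepGK : row_indep (G *m K^T).
  have GV : G *m (col_mx H K)^T = row_mx 0 (G *m K^T).
    by rewrite tr_col_mx mul_mx_row -[G *m H^T]trmxK trmx_mul trmxK HG trmx0.
  rewrite -(row_indep_row0 m) -GV row_indep_mul //.
  by rewrite row_indep_unitmx unitmx_tr.
have [M W_unit] := steinitzR indepGK; set W := col_mx _ M in W_unit.
have WT_unit : W^T \in unitmx by rewrite unitmx_tr.
exists (invmx W^T *m K).
  have -> : col_mx H (invmx W^T *m K) = block_mx 1%:M 0 0 (invmx W^T) *m col_mx H K.
    by rewrite mul_block_col mul1mx !mul0mx addr0 add0r.
  by rewrite unitmx_mul block_diag_mx_unit unitmx1 unitmx_inv WT_unit.
have KG : K *m G^T = W^T *m col_mx 1%:M 0.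
  by rewrite tr_col_mx mul_row_col mulmx1 mulmx0 addr0 trmx_mul trmxK.
by rewrite -mulmxA KG mulKmx.
Qed.

Lemma card_indep_extensions_orth m k s
    (H : 'M[R]_(m, m + (k + s))) (G : 'M_(k, m + (k + s))) :
  row_indep H -> row_indep G -> H *m G^T = 0 ->
  #|[set b : 'rV_(m + (k + s)) | row_indep (col_mx b H) && (b *m G^T == 0)]| =
    (#|R| ^ m * jordan_totient s)%N.
Proof.
move=> indepH indepG HG; have [K V_unit KG] := dual_completion indepH indepG HG.
pose coord (p : 'rV[R]_m * 'rV[R]_s) := row_mx p.1 (row_mx 0 p.2) *m col_mx H K.
have coord_inj : injective coord.
  move=> [a w] [a' w'] /(congr1 (mulmx^~ (invmx (col_mx H K)))).
  by rewrite /= !mulmxK // => /eq_row_mx[/= -> /eq_row_mx[_ /= ->]].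
have coordG (a : 'rV_m) (w : 'rV_(k + s)) :
    row_mx a w *m col_mx H K *m G^T = lsubmx w.
  rewrite mul_row_col mulmxDl -!mulmxA HG KG mulmx0 add0r -{1}[w]hsubmxK.
  by rewrite mul_row_col mulmx1 mulmx0 addr0.
have -> : (#|R| ^ m)%N = #|{: 'rV[R]_m}| by rewrite card_mx mul1n.
rewrite -cardsT -cardsX -(card_imset _ coord_inj).
apply: eq_card => b; rewrite inE; apply/andP/imsetP => [[indepb /eqP bG] | [[a w]]].
  have [a [w bE]] : exists a w, b = row_mx a w *m col_mx H K.
    exists (lsubmx (b *m invmx (col_mx H K))), (rsubmx (b *m invmx (col_mx H K))).
    by rewrite hsubmxK mulmxKV.
  have w0 : lsubmx w = 0 by rewrite -(coordG a) -bE.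
  exists (a, rsubmx w); last by rewrite bE /coord /= -w0 hsubmxK.
  by rewrite !inE -(row_indep_row0 k) -w0 hsubmxK -(row_indep_completion a _ V_unit) -bE.
rewrite !inE /coord /= => indepw ->.
by rewrite row_indep_completion // row_indep_row0 indepw coordG row_mxKl.
Qed.

Lemma card_indep_frames m l : (m <= l)%N ->
  #|[set H : 'M[R]_(m, l) | row_indep H]| =
    (\prod_(j < m) (#|R| ^ j * jordan_totient (l - j)))%N.
Proof.
move=> m_l; apply: (@card_mx_tower _ _ m (fun j (H : 'M_(j, l)) => row_indep H)
  (fun j => #|R| ^ j * jordan_totient (l - j))%N).
- exact: row_indep0.
- by move=> j b H /(@row_indep_dsub 1).
move=> j H j_m indepH; have : l = (j + (l - j))%N by lia.
move: (l - j)%N => s ls; move: H indepH {m_l}; rewrite ls => H indepH.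
rewrite -(@card_indep_extensions_orth _ 0 s H 0) ?row_indep0 ?trmx0 ?mulmx0 //.
by apply: eq_card => b; rewrite !inE mulmx0 eqxx andbT.
Qed.

Lemma card_isotropic_frames m l (L : 'M[R]_l) :
  L \in unitmx -> alternating L -> (2 * m <= l)%N ->
  #|isotropic_frames m L| =
    (\prod_(j < m) (#|R| ^ j * jordan_totient (l - 2 * j)))%N.
Proof.
move=> L_unit altL m_l.
pose P j (H : 'M[R]_(j, l)) := row_indep H && isotropic L H.
apply: (@card_mx_tower _ _ m P
  (fun j => #|R| ^ j * jordan_totient (l - 2 * j))%N) => [H | j b H | j H j_m].
- by rewrite /P row_indep0 /isotropic [H]flatmx0 !mul0mx eqxx.
- by rewrite /P isotropic_col_mx // => /and3P[/(@row_indep_dsub 1)-> ->].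
rewrite /P => /andP[indepH isoH].
have : l = (j + (j + (l - 2 * j)))%N by lia.
move: (l - 2 * j)%N => s ls; move: L H L_unit altL indepH isoH {P m_l}.
rewrite ls => L H L_unit altL indepH isoH.
rewrite -(@card_indep_extensions_orth j j s H (H *m L)) //.
- by apply: eq_card => b; rewrite !inE isotropic_col_mx // isoH.
- by rewrite row_indep_mul ?row_indep_unitmx.
- by rewrite -[LHS]trmxK trmx_mul trmxK (eqP isoH) trmx0.
Qed.

Lemma card_isotropic_spaces m l (L : 'M[R]_l) :
  L \in unitmx -> alternating L -> (2 * m <= l)%N ->
  #|isotropic_spaces m L|%:R =
    \prod_(j < m) ((jordan_totient (l - 2 * j))%:R / (jordan_totient (m - j))%:R) :> rat.
Proof.
move=> L_unit altL m_l; have := card_isotropic_frames_spaces m L.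
have bases_neq0 : #|[set X : 'M[R]_m | row_indep X]|%:R != 0 :> rat.
  rewrite pnatr_eq0 -lt0n; apply/card_gt0P; exists 1%:M.
  by rewrite inE row_indep_unitmx unitmx1.
move=> /(congr1 (fun x => x%:R : rat)); rewrite natrM => /(canLR (mulfK bases_neq0)) <-.
rewrite card_isotropic_frames // card_indep_frames // !natr_prod -prodf_div.
apply: eq_bigr => j _; rewrite !natrM -mulf_div divff ?mul1r //.
by rewrite pnatr_eq0 -lt0n expn_gt0 (cardD1 0).
Qed.

End IndependentRows.

Lemma Zp_Steinitz_ring (q : nat) : Steinitz_ring 'Z_q.
Proof.
move=> m r H indepH.
pose f : {rmorphism int -> 'Z_q} := intr.
(* Smith normal form is available over the integers only, hence the lift. *)
pose lift := map_mx (fun x : 'Z_q => (x : nat)%:Z) H.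
have [L L_unit [P P_unit [d _ liftE]]] := int_Smith_normal_form lift.
have fP_unit : map_mx f P \in unitmx.
  by move: P_unit; rewrite !unitmxE det_map_mx; apply: rmorph_unit.
pose M := map_mx f L *m diag_mx (\row_(i < m) f d`_i).
have HE : H = M *m (row_mx 1%:M 0 *m map_mx f P).
  have -> : H = map_mx f lift.
    by apply/matrixP => i j; rewrite !mxE /= -pmulrn natr_Zp.
  rewrite liftE !map_mxM /= -!mulmxA; congr (_ *m _); rewrite !mulmxA; congr (_ *m _).
  apply/matrixP => i j; rewrite mul_mx_row mulmx1 mulmx0 !mxE.
  by case: splitP => k jk; rewrite !mxE jk rmorphMn //= ltn_eqF // ltn_addr.
have M_unit : M \in unitmx.
  rewrite -row_indep_unitmx; apply/row_indepP => x xM.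
  by move/row_indepP: indepH; apply; rewrite HE (mulmxA x) xM mul0mx.
exists (row_mx 0 1%:M *m map_mx f P).
have -> : col_mx H (row_mx 0 1%:M *m map_mx f P) = block_mx M 0 0 1%:M *m map_mx f P.
  by rewrite HE mulmxA -mul_col_mx mul_mx_row mulmx1 mulmx0.
by rewrite unitmx_mul block_diag_mx_unit M_unit unitmx1.
Qed.

Lemma card_Zp_dvdn (q e : nat) : (1 < q)%N -> (e %| q)%N ->
  #|[pred x : 'Z_q | (e %| x)%N]| = (q %/ e)%N.
Proof.
move=> q_gt1 e_dvd.
rewrite -sum1_card big_mkcond /=.
rewrite -(big_mkord xpredT (fun i => if (e %| i)%N then 1%N else 0%N)).
rewrite Zp_cast // divn_count_dvd.
rewrite big_ltn ?(ltnW q_gt1) // dvdn0 [RHS]big_nat_recr ?(ltnW q_gt1) //= e_dvd addnC.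
by congr addn; apply: eq_bigr => i _; case: (_ %| _)%N.
Qed.

Definition content (q r : nat) (v : 'rV['Z_q]_r) : nat :=
  \big[gcdn/0%N]_i nat_of_ord (v 0 i).

Lemma card_dvdn_content (q r e : nat) : (1 < q)%N -> (e %| q)%N ->
  #|[set v : 'rV['Z_q]_r | (e %| content v)%N]| = ((q %/ e) ^ r)%N.
Proof.
move=> q_gt1 e_dvd; rewrite -(card_Zp_dvdn q_gt1 e_dvd) -card_rV_on.
apply: eq_card => v; rewrite !inE.
by apply/dvdn_biggcdP/forallP => e_v i; have := e_v i; rewrite inE // => /(_ isT).
Qed.

Lemma Zp_natr_eq0 (q a : nat) : (1 < q)%N -> (a%:R == 0 :> 'Z_q) = (q %| a)%N.
Proof. by move=> q_gt1; rewrite -val_eqE /= val_Zp_nat. Qed.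

Lemma Zp_natr_scale_eq0 (q r a : nat) (v : 'rV['Z_q]_r) : (1 < q)%N ->
  (a%:R *: v == 0) = (q %| a * content v)%N.
Proof.
move=> q_gt1; rewrite (big_morph (muln a) (muln_gcdr a) (muln0 a)).
have entry i : ((a%:R *: v) 0 i == 0) = (q %| a * (v 0 i)%R)%N.
  by rewrite mxE -[X in _ * X]natr_Zp -natrM Zp_natr_eq0.
apply/eqP/dvdn_biggcdP => [av i _ | q_av].
  by rewrite -entry av mxE.
by apply/rowP => i; apply/eqP; rewrite [eqbRHS]mxE entry q_av.
Qed.

Lemma row_indep_coprime (q r : nat) (v : 'rV['Z_q]_r) : (1 < q)%N ->
  row_indep v = coprime q (content v).
Proof.
move=> q_gt1; have gcd_q := dvdn_gcdl q (content v).
apply/row_indepP/idP => [indep | co_qv x].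
  have : (q %/ gcdn q (content v))%:R *: v == 0.
    by rewrite Zp_natr_scale_eq0 // -[X in (X %| _)%N](divnK gcd_q) dvdn_mul ?dvdn_gcdr.
  rewrite -mul_scalar_mx => /eqP/indep/matrixP/(_ 0 0)/eqP.
  rewrite !mxE eqxx Zp_natr_eq0 // dvdn_divRL // -[X in (_ %| X)%N]muln1.
  by rewrite dvdn_pmul2l ?(ltnW q_gt1) // dvdn1.
rewrite [x]mx11_scalar mul_scalar_mx -[x 0 0]natr_Zp => /eqP.
rewrite Zp_natr_scale_eq0 // Gauss_dvdl // -Zp_natr_eq0 // => /eqP->.
exact: raddf0.
Qed.

Lemma jordan_totientE (q r : nat) : (1 < q)%N ->
  (jordan_totient 'Z_q r)%:R =
    q%:R ^+ r * \prod_(p <- primes q) (1 - (p%:R : rat) ^- r).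
Proof.
move=> q_gt1.
have card_rV : #|{: 'rV['Z_q]_r}| = (q ^ r)%N by rewrite card_mx mul1n card_ord Zp_cast.
rewrite /jordan_totient; under eq_finset do rewrite row_indep_coprime //.
rewrite -natrX -card_rV (@card_coprime _ _ _ (fun e => (e%:R : rat) ^- r)) ?(ltnW q_gt1) //.
  by move=> a b _; rewrite natrM exprMn invfM.
move=> e e_dvd; rewrite card_dvdn_content // card_rV !natrX -expr_div_n.
by rewrite -[in RHS](divnK e_dvd) natrM mulfK // pnatr_eq0 -lt0n (dvdn_gt0 _ e_dvd) // ltnW.
Qed.

Lemma Lambda_unit (q n : nat) : Lambda q n \in unitmx.
Proof.
have Lambda_inv : Lambda q n *m (- Lambda q n) = 1%:M.
  rewrite mulmxN mulmx_block !mulmx0 !mul0mx !mulmx1 !mul1mx !addr0 !add0r.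
  by rewrite opp_block_mx opprK oppr0 -scalar_mx_block.
exact: (mulmx1_unit Lambda_inv).1.
Qed.

Lemma Lambda_alternating (q n : nat) : alternating (Lambda q n).
Proof.
move=> a; rewrite -[a]hsubmxK; set u := lsubmx a; set v := rsubmx a.
rewrite mul_row_block !mulmx0 mulmx1 mulmxN mulmx1 add0r addr0 tr_row_mx mul_row_col.
rewrite mulNmx -[u *m _]trmxK trmx_mul trmxK.
by rewrite [v *m u^T]mx11_scalar tr_scalar_mx addNr.
Qed.

Section CheckMatrix.

Variables (q n m : nat).
Implicit Type a : {ffun 'I_m -> 'rV['Z_q]_(n + n)}.

(* The transpose of the check matrix of the paper: generators are rows here. *)
Definition check_mx a : 'M['Z_q]_(m, n + n) := \matrix_j a j.

Lemma mul_check_mx (x : {ffun 'I_m -> 'Z_q}) a :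
  (\row_j x j) *m check_mx a = \sum_j x j *: a j.
Proof. by rewrite mulmx_sum_row; apply: eq_bigr => j _; rewrite rowK mxE. Qed.

Lemma row_of_ffun (x : 'rV['Z_q]_m) : \row_j [ffun j => x 0 j] j = x.
Proof. by apply/rowP => j; rewrite mxE ffunE. Qed.

Lemma lin_indepE a : lin_indep a = row_indep (check_mx a).
Proof.
apply/forallP/row_indepP => [indep x | indep x].
  rewrite -(row_of_ffun x) mul_check_mx => /eqP/(implyP (indep _))/forallP x0.
  by apply/rowP => j; rewrite !mxE; apply/eqP.
apply/implyP; rewrite -mul_check_mx => /eqP/indep/rowP x0; apply/forallP => j.
by have := x0 j; rewrite !mxE => ->.
Qed.

Lemma pairwise_orthE a : pairwise_orth a = isotropic (Lambda q n) (check_mx a).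
Proof.
have entry i j :
    (check_mx a *m Lambda q n *m (check_mx a)^T) i j = sympl (a i) (a j).
  rewrite /sympl -[a i](rowK a) -[a j](rowK a) -/(check_mx a) -row_mul tr_row.
  by rewrite !mxE; apply: eq_bigr => l _; rewrite !mxE.
apply/forallP/eqP => [orth | orth i].
  by apply/matrixP => i j; rewrite entry mxE; apply/eqP/(forallP (orth i)).
by apply/forallP => j; rewrite -entry orth mxE.
Qed.

Lemma span_setE a : span_set a = row_span (check_mx a).
Proof.
apply/setP => v; apply/imsetP/imsetP => -[x _ ->].
  by exists (\row_j x j); rewrite ?mul_check_mx.
by exists [ffun j => x 0 j]; rewrite -?mul_check_mx ?row_of_ffun.
Qed.

End CheckMatrix.

Lemma stab_codesE (n k q : nat) :
  stab_codes n k q = isotropic_spaces (n - k) (Lambda q n).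
Proof.
apply/setP => C; rewrite inE; apply/existsP/imsetP => [[a] | [A]].
  case/and3P=> indep orth /eqP->; exists (check_mx a); last exact: span_setE.
  by rewrite inE -lin_indepE indep -pairwise_orthE.
rewrite inE => frameA ->; exists [ffun j => row j A].
have AE : check_mx [ffun j => row j A] = A.
  by apply/row_matrixP => j; rewrite rowK ffunE.
by rewrite lin_indepE pairwise_orthE span_setE AE eqxx andbT.
Qed.

Lemma N_jordan_totient (n k q : nat) :
  (N n k q)%:R = \prod_(j < n - k)
    ((jordan_totient 'Z_q (2 * (n - j)))%:R / (jordan_totient 'Z_q (n - k - j))%:R) :> rat.
Proof.
rewrite /N stab_codesE card_isotropic_spaces; first last.
- by rewrite addnn -mul2n leq_mul2l leq_subr orbT.
- exact: Lambda_alternating.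
- exact: Lambda_unit.
- exact: Zp_Steinitz_ring.
by apply: eq_bigr => j _; rewrite addnn -mul2n -mulnBr.
Qed.

Lemma N_closed_form (n k q : nat) : (1 < q)%N ->
  (N n k q)%:R =
    (q%:R : rat) ^+ (((n - k) * (n + 3 * k + 1)) %/ 2) *
    \prod_(p <- primes q)
       \prod_(j < n - k)
         ((1 - (p%:R : rat) ^- (2 * (n - j))) / (1 - (p%:R : rat) ^- (n - k - j))).
Proof.
move=> q_gt1; have q_neq0 : (q%:R : rat) != 0 by rewrite pnatr_eq0 -lt0n ltnW.
have -> : ((n - k) * (n + 3 * k + 1) %/ 2 = \sum_(j < n - k) (n + k - j))%N.
  by rewrite sum_subn_ord; [congr (_ %/ 2)%N; nia | lia].
rewrite N_jordan_totient exchange_big -prodrXr -big_split; apply: eq_bigr => j _ /=.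
have j_lt := ltn_ord j; rewrite !jordan_totientE // -mulf_div prodf_div -expfB_cond.
  by congr (_ ^+ _ * _); lia.
by rewrite (negPf q_neq0); lia.
Qed.

Lemma N_prod_primes (n k d : nat) : (1 < d)%N ->
  N n k d = (\prod_(p <- primes d) N n k (p ^ logn p d))%N.
Proof.
move=> d_gt1; apply/eqP; rewrite -(eqr_nat rat) natr_prod N_closed_form //.
rewrite -[X in X%:R ^+ _](prod_primes_logn (ltnW d_gt1)) natr_prod -prodrXl -big_split /=.
apply/eqP/eq_big_seq => p; rewrite mem_primes => /and3P[p_pr d_gt0 p_d].
have logp_gt0 : (0 < logn p d)%N by rewrite logn_gt0 mem_primes p_pr d_gt0.
rewrite N_closed_form ?primesX ?primes_prime ?big_seq1 //.
by rewrite -(exp1n (logn p d)) ltn_exp2r ?prime_gt1.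
Qed.

Theorem theorem2 (d n k : nat) (hd : (2 <= d)%N) (hn : (1 <= n)%N) (hk : (k < n)%N) :
  N n k d = (\prod_(p <- primes d) N n k (p ^ logn p d))%N /\
  (N n k d)%:R =
    (d%:R : rat) ^+ (((n - k) * (n + 3 * k + 1)) %/ 2) *
    \prod_(p <- primes d)
       \prod_(j < n - k)
         ((1 - (p%:R : rat) ^- (2 * (n - j))) / (1 - (p%:R : rat) ^- (n - k - j))).
Proof.
by split; [exact: N_prod_primes | exact: N_closed_form].
Qed.
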